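(* Let $N,d\ge 1$ and let $f_1,\dots,f_N:\mathbb R^d\to\mathbb R$ be convex functions such that $L_i:=\sup_{z\in\mathbb R^d}\sup_{g\in\partial f_i(z)}\|g\|_1<\infty$ for each $i$, and such that $f:=\sum_{i=1}^N f_i$ has at least one minimizer on $\mathbb R^d$. Let $\hat A(t)=(\hat a_{ij}(t))$, $t\ge0$, be $N\times N$ column-stochastic matrices with no zero rows satisfying $$\hat a^+:=\inf_{t\ge0}\Big[\min_{i,j:\,\hat a_{ij}(t)>0}\hat a_{ij}(t)\Big]>0$$ and, for some $T\in\mathbb N$, $$\hat A(t+T-1)\cdots\hat A(t+1)\hat A(t)>0\qquad\text{for all }t\ge0.$$ Let $\alpha\in[-1,-1/2)$, $c>0$, and let $\theta(t)=ct^\alpha$ for $t\ge1$, with $\theta(0)\ge0$ arbitrary. Let $\hat y_i(t)\in\mathbb R$ and $\hat x_i(t),\hat w_i(t)\in\mathbb R^d$ satisfy, for $1\le i\le N$ and $t\ge0$, $$\hat y_i(t+1)=\sum_{j=1}^N\hat a_{ij}(t)\hat y_j(t),$$ $$\hat x_i(t)=\hat w_i(t)-\theta(t)\hat g_i(t),\qquad \hat g_i(t)\in\partial f_i\Big(\frac{\hat w_i(t)}{\hat y_i(t)}\Big),$$ $$\hat w_i(t+1)=\sum_{j=1}^N\hat a_{ij}(t)\hat x_j(t),$$ with $\hat y_i(0)>0$ for all $i$ and $\hat w_i(0)\in\mathbb R^d$ arbitrary. Then there exists a minimizer $x^*$ of $f$ such that $$\lim_{t\to\infty}\frac{\hat w_i(t)}{\hat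 y_i(t)}=\lim_{t\to\infty}\frac{\hat x_i(t)}{\hat y_i(t)}=x^*\qquad\text{for all }1\le i\le N.$$
   Context: A nonnegative square matrix is column-stochastic if each of its columns sums to $1$. For a matrix $A$, $A>0$ means every entry is positive. $\partial f_i(z)$ is the (convex) subdifferential of $f_i$ at $z$, and $\|g\|_1=\sum_l|g_l|$. *)

(* Defs.v *)
From HB Require Import structures.
From mathcomp Require Import all_boot all_order all_algebra.
From mathcomp Require Import all_classical all_reals all_analysis.

Set Implicit Arguments.
Unset Strict Implicit.
Unset Printing Implicit Defensive.

Import Order.TTheory GRing.Theory Num.Theory.
Import numFieldNormedType.Exports.

Local Open Scope classical_set_scope.
Local Open Scope ring_scope.

Definition column_stochastic (R : realType) (N : nat) (A : 'M[R]_N) : Prop :=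
  (forall i j, 0 <= A i j) /\ (forall j, \sum_i A i j = 1).

Definition positive_mx (R : realType) (N : nat) (A : 'M[R]_N) : Prop :=
  forall i j, 0 < A i j.

(* Extended-real valued, so that the minimum of an empty family is +oo; a
   column-stochastic matrix of size at least 1 has a positive entry. *)
Definition min_positive_entry (R : realType) (N : nat) (A : 'M[R]_N) : \bar R :=
  \big[mine/+oo%E]_(p : 'I_N * 'I_N | 0 < A p.1 p.2) (A p.1 p.2)%:E.

(* [mx_window A t T] is A(t+T-1) *m ... *m A(t+1) *m A(t). *)
Fixpoint mx_window (R : realType) (N : nat) (A : nat -> 'M[R]_N) (t T : nat) :
    'M[R]_N :=
  if T is T'.+1 then A (t + T')%N *m mx_window A t T' else 1%:M.

Definition dotp (R : realType) (d : nat) (u v : 'rV[R]_d) : R :=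
  \sum_l u 0 l * v 0 l.

(* The library norm on matrices is the sup norm, hence this definition. *)
Definition norm1 (R : realType) (d : nat) (g : 'rV[R]_d) : R :=
  \sum_l `|g 0 l|.

Definition subdifferential (R : realType) (d : nat) (f : 'rV[R]_d -> R)
    (z : 'rV[R]_d) : set 'rV[R]_d :=
  [set g | forall u, f z + dotp g (u - z) <= f u].

Definition subgradient_bound (R : realType) (d : nat) (f : 'rV[R]_d -> R) :
    \bar R :=
  ereal_sup [set ereal_sup [set (norm1 g)%:E | g in subdifferential f z]
            | z in [set: 'rV[R]_d]].

Definition minimizer (R : realType) (d : nat) (f : 'rV[R]_d -> R)
    (x : 'rV[R]_d) : Prop :=
  forall z, f x <= f z.

(* Main.v *)
(* The weighted mean s(t) of the ratios z_i(t) = w_i(t) / y_i(t), with weights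
   y_i(t) / sum_j y_j(t), obeys s(t+1) = s(t) - (theta(t) / sum y) sum_i g_i(t).
   Over a window of length T the ratios are averaged by a row-stochastic matrix
   whose entries are bounded below, so their spread D(t) contracts up to a
   perturbation O(theta); since sum theta^2 < oo this gives sum D^2 < oo.  Each
   f_i is L_i-Lipschitz (a finite convex function has a subgradient everywhere),
   so s follows an approximate subgradient method for f with errors
   O(theta^2 + D^2): |s - x|^2 is nonincreasing up to a summable error for every
   minimizer x, and sum theta = oo forces liminf f(s) = min f. *)
Require Import Defs.
From HB Require Import structures.
From mathcomp Require Import all_boot all_order all_algebra.
From mathcomp Require Import all_classical all_reals all_analysis.
From mathcomp Require Import ring lra.

Set Implicit Arguments.
Unset Strict Implicit.
Unset Printing Implicit Defensive.

Import Order.TTheory GRing.Theory Num.Theory.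
Import numFieldNormedType.Exports.

Local Open Scope classical_set_scope.
Local Open Scope ring_scope.

(** * Subgradients of convex functions *)

Lemma dotpC (R : realType) (d : nat) (u v : 'rV[R]_d) : dotp u v = dotp v u.
Proof. by apply: eq_bigr => l _; rewrite mulrC. Qed.

Lemma dotpDl (R : realType) (d : nat) (u v h : 'rV[R]_d) :
  dotp (u + v) h = dotp u h + dotp v h.
Proof. by rewrite -big_split; apply: eq_bigr => l _; rewrite mxE mulrDl. Qed.

Lemma dotpZl (R : realType) (d : nat) (a : R) (u h : 'rV[R]_d) :
  dotp (a *: u) h = a * dotp u h.
Proof. by rewrite mulr_sumr; apply: eq_bigr => l _; rewrite mxE mulrA. Qed.

Lemma dotpDr (R : realType) (d : nat) (u v h : 'rV[R]_d) :
  dotp h (u + v) = dotp h u + dotp h v.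
Proof. by rewrite !(dotpC h) dotpDl. Qed.

Lemma dotpZr (R : realType) (d : nat) (a : R) (u h : 'rV[R]_d) :
  dotp h (a *: u) = a * dotp h u.
Proof. by rewrite !(dotpC h) dotpZl. Qed.

Lemma dotpNr (R : realType) (d : nat) (u h : 'rV[R]_d) : dotp h (- u) = - dotp h u.
Proof. by rewrite -scaleN1r dotpZr mulN1r. Qed.

Lemma dotpNl (R : realType) (d : nat) (u h : 'rV[R]_d) : dotp (- u) h = - dotp u h.
Proof. by rewrite -scaleN1r dotpZl mulN1r. Qed.

Lemma dotp_delta (R : realType) (d : nat) (k : 'I_d) (h : 'rV[R]_d) :
  dotp (delta_mx 0 k) h = h 0 k.
Proof.
rewrite /dotp (bigD1 k)//= mxE !eqxx mul1r big1 ?addr0// => l lk.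
by rewrite mxE (negbTE lk) andbF mul0r.
Qed.

Lemma dotp_suml (R : realType) (d : nat) (I : finType) (u : I -> 'rV[R]_d)
    (h : 'rV[R]_d) :
  dotp (\sum_i u i) h = \sum_i dotp (u i) h.
Proof.
rewrite /dotp exchange_big; apply: eq_bigr => l _.
by rewrite summxE mulr_suml.
Qed.

Lemma ler_coord_norm (R : realType) (d : nat) (u : 'rV[R]_d) (l : 'I_d) :
  `|u 0 l| <= `|u|.
Proof.
by rewrite [leRHS]/Num.Def.normr/= mx_normrE (le_bigmax _ _ ((0, l) : 'I_1 * 'I_d)).
Qed.

Lemma ler_norm_norm1 (R : realType) (d : nat) (u : 'rV[R]_d) : `|u| <= norm1 u.
Proof.
rewrite [leLHS]/Num.Def.normr/= mx_normrE; apply: bigmax_le => [|[i l] _]/=.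
  exact: sumr_ge0.
rewrite (ord1 i) /norm1 (bigD1 l)//= lerDl; exact: sumr_ge0.
Qed.

(** Hölder's inequality for the dual pair of the 1-norm and the sup norm [|v|]. *)
Lemma ler_norm_dotp (R : realType) (d : nat) (u v : 'rV[R]_d) :
  `|dotp u v| <= norm1 u * `|v|.
Proof.
apply: le_trans (ler_norm_sum _ _ _) _; rewrite mulr_suml.
by apply: ler_sum => l _; rewrite normrM ler_wpM2l// ler_coord_norm.
Qed.

Lemma dotp_sqr_ge0 (R : realType) (d : nat) (u : 'rV[R]_d) : 0 <= dotp u u.
Proof. by apply: sumr_ge0 => l _; rewrite -expr2 sqr_ge0. Qed.

(** The sup norm is attained at some coordinate, whose square is one term of [dotp u u]. *)
Lemma sqr_norm_le_dotp (R : realType) (d : nat) (u : 'rV[R]_d) :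
  `|u| ^+ 2 <= dotp u u.
Proof.
have [->|u0] := eqVneq u 0; first by rewrite normr0 expr0n/= dotp_sqr_ge0.
have /mx_norm_neq0[[i l]] : mx_norm u != 0 by move: u0; rewrite -normr_eq0.
rewrite -[mx_norm u]/`|u|/= (ord1 i) => ->.
rewrite real_normK ?num_real// /dotp (bigD1 l)//= -expr2 lerDl.
by apply: sumr_ge0 => k _; rewrite -expr2 sqr_ge0.
Qed.

Lemma dotp_sqr_le (R : realType) (d : nat) (u : 'rV[R]_d) (a : R) :
  norm1 u <= a -> dotp u u <= a ^+ 2.
Proof.
move=> ua; apply: le_trans (ler_norm _) _; apply: le_trans (ler_norm_dotp _ _) _.
rewrite expr2; apply: ler_pM => //; first exact: sumr_ge0.
exact: le_trans (ler_norm_norm1 _) ua.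
Qed.

Lemma norm1D (R : realType) (d : nat) (u v : 'rV[R]_d) :
  norm1 (u + v) <= norm1 u + norm1 v.
Proof.
by rewrite -big_split; apply: ler_sum => l _; rewrite mxE ler_normD.
Qed.

Lemma norm1_sum (R : realType) (d : nat) (I : finType) (u : I -> 'rV[R]_d) :
  norm1 (\sum_i u i) <= \sum_i norm1 (u i).
Proof.
elim/big_rec2 : _ => [|i v a _ le_va].
  by rewrite /norm1 big1// => l _; rewrite mxE normr0.
by apply: le_trans (norm1D _ _) _; rewrite lerD2l.
Qed.

Lemma convex_functionP (R : realType) (d : nat) (f : 'rV[R]_d -> R) :
  convex_function [set: convex_lmodType 'rV[R]_d] f ->
  forall (a b : R) (u v : 'rV[R]_d), 0 <= a -> 0 <= b -> a + b = 1 ->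
  f (a *: u + b *: v) <= a * f u + b * f v.
Proof.
move=> cf a b u v a0 b0 ab.
have a1 : a <= 1 by lra.
have := cf (Itv01 a0 a1) u v (in_setT _) (in_setT _).
rewrite convRE /conv/= /unstable.onem.
by have -> : 1 - a = b by lra.
Qed.

(* Hahn-Banach in finite dimension: the minorant is extended one coordinate at
   a time, the slope [c] along the [k]-th basis vector being a supremum. *)
Lemma convex_linear_minorant (R : realType) (d : nat) (phi : 'rV[R]_d -> R) :
  convex_function [set: convex_lmodType 'rV[R]_d] phi -> phi 0 = 0 ->
  exists g, forall h, dotp g h <= phi h.
Proof.
move=> /convex_functionP cphi phi0.
suff /(_ d (leqnn d))[g gP] : forall k, (k <= d)%N -> exists g, forall h : 'rV[R]_d,
    (forall l : 'I_d, (k <= l)%N -> h 0 l = 0) -> dotp g h <= phi h.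
  by exists g => h; apply: gP => l; rewrite leqNgt ltn_ord.
elim=> [_|k IHk kd].
  exists 0 => h h0; have -> : h = 0 by apply/rowP => l; rewrite h0// mxE.
  by rewrite phi0 /dotp big1// => l _; rewrite !mxE mul0r.
have [g gP] := IHk (ltnW kd).
pose sp : set 'rV[R]_d := [set h | forall l : 'I_d, (k <= l)%N -> h 0 l = 0].
pose e : 'rV[R]_d := delta_mx 0 (Ordinal kd).
(* Every lower bound for the new slope lies below every upper bound. The weights [s / (r + s)] and
   [r / (r + s)] cancel the [e] components, so convexity compares with a point of [sp], where [g] is
   already a minorant. *)
have slope h h' r s : sp h -> sp h' -> 0 < r -> 0 < s ->
    (dotp g h' - phi (h' - r *: e)) / r <= (phi (h + s *: e) - dotp g h) / s.
  move=> sph sph' r0 s0; have rs0 : 0 < r + s by exact: addr_gt0.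
  rewrite ler_pdivrMr// mulrAC ler_pdivlMr//.
  have sa0 : 0 <= s / (r + s) by rewrite divr_ge0// ltW.
  have ra0 : 0 <= r / (r + s) by rewrite divr_ge0// ltW.
  have sr1 : s / (r + s) + r / (r + s) = 1 by rewrite -mulrDl addrC divff// gt_eqF.
  have := cphi _ _ (h' - r *: e) (h + s *: e) sa0 ra0 sr1.
  have -> : (s / (r + s)) *: (h' - r *: e) + (r / (r + s)) *: (h + s *: e) =
      (s / (r + s)) *: h' + (r / (r + s)) *: h.
    by apply/rowP => l; rewrite !mxE; ring.
  have /gP : sp ((s / (r + s)) *: h' + (r / (r + s)) *: h).
    by move=> l kl; rewrite !mxE sph// sph'// !mulr0 addr0.
  rewrite dotpDr !dotpZr => /le_trans/[apply].
  rewrite -(ler_pM2l rs0).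
  have E a b : (r + s) * (s / (r + s) * a + r / (r + s) * b) = s * a + r * b.
    by field; rewrite gt_eqF.
  rewrite !E; lra.
pose S := [set (dotp g h.1 - phi (h.1 - h.2 *: e)) / h.2 |
            h in [set h : 'rV[R]_d * R | sp h.1 /\ 0 < h.2]].
have sp0 : sp 0 by move=> l _; rewrite mxE.
have S0 : S !=set0 by eexists; exists (0, 1).
have Sub h s : sp h -> 0 < s -> ubound S ((phi (h + s *: e) - dotp g h) / s).
  by move=> sph s0 _ [[h' r] /= [sph' r0] <-]; exact: slope.
pose c := sup S.
have cr h s : sp h -> 0 < s -> dotp g h + s * c <= phi (h + s *: e).
  move=> sph s0; have := ge_sup S0 (Sub _ _ sph s0).
  rewrite ler_pdivlMr// -/c; lra.
have cl h r : sp h -> 0 < r -> dotp g h - r * c <= phi (h - r *: e).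
  move=> sph r0.
  have : (dotp g h - phi (h - r *: e)) / r <= c.
    by apply: ub_le_sup; [eexists; exact: (Sub _ _ sp0 ltr01)|exists (h, r)].
  rewrite ler_pdivrMr//; lra.
(* [g] is controlled only on [sp] and may have any [k]-th coordinate; the correction makes the new
   functional take the value [c] at [e]. *)
exists (g + (c - dotp g e) *: e) => h hP.
pose s := h 0 (Ordinal kd).
have sph : sp (h - s *: e).
  move=> l; rewrite leq_eqVlt => /predU1P[kl|kl].
    have -> : l = Ordinal kd by exact/val_inj.
    by rewrite !mxE !eqxx/= mulr1 subrr.
  rewrite !mxE hP//= -val_eqE/= gtn_eqF// mulr0 subr0//.
have -> : dotp (g + (c - dotp g e) *: e) h = dotp g (h - s *: e) + s * c.
  rewrite dotpDl dotpZl dotp_delta -/s dotpDr dotpNr dotpZr; ring.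
have hE : h = (h - s *: e) + s *: e by rewrite subrK.
rewrite [in leRHS]hE.
have [s0|s0|s0] := ltgtP s 0.
- have := cl _ (- s) sph; rewrite oppr_gt0 s0 scaleNr opprK mulNr opprK.
  exact.
- exact: cr.
- rewrite s0 mul0r scale0r !addr0 subr0.
  by move: sph; rewrite s0 scale0r subr0; exact: gP.
Qed.

(** The linear minorant of the increment [f (z + h) - f z], which vanishes at [h = 0], is a
    subgradient at [z]. *)
Lemma convex_subdifferential_neq0 (R : realType) (d : nat) (f : 'rV[R]_d -> R) :
  convex_function [set: convex_lmodType 'rV[R]_d] f ->
  forall z, subdifferential f z !=set0.
Proof.
move=> /convex_functionP cf z.
have [||g gP] := @convex_linear_minorant R d (fun h => f (z + h) - f z).
- move=> t u v _ _; rewrite convRE /conv/= /unstable.onem.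
  have a0 : 0 <= t%:num by exact: ge0.
  have b0 : 0 <= 1 - t%:num by rewrite subr_ge0 le1.
  set a := t%:num in a0 b0 *.
  have := cf a (1 - a) (z + u) (z + v) a0 b0 (subrKC _ _).
  have -> : a *: (z + u) + (1 - a) *: (z + v) = z + (a *: u + (1 - a) *: v).
    by apply/rowP => l; rewrite !mxE; ring.
  move=> /le_trans le_f; rewrite lerBlDr; apply: le_f.
  by rewrite /GRing.scale/=; lra.
- by rewrite addr0 subrr.
by exists g => u; have := gP (u - z); rewrite subrKC; lra.
Qed.

Lemma subgradient_boundP (R : realType) (d : nat) (f : 'rV[R]_d -> R) :
  convex_function [set: convex_lmodType 'rV[R]_d] f ->
  (subgradient_bound f < +oo)%E ->
  exists2 L : R, 0 <= L & forall z g, subdifferential f z g -> norm1 g <= L.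
Proof.
move=> cf fb.
have ub z g : subdifferential f z g -> ((norm1 g)%:E <= subgradient_bound f)%E.
  move=> fg; apply: (@le_trans _ _ (ereal_sup [set (norm1 g)%:E | g in subdifferential f z])).
    by apply: ereal_sup_ubound; exists g.
  by apply: ereal_sup_ubound; exists z.
(* A single subgradient rules out the value [-oo] of the supremum and forces the real bound to be
   nonnegative. *)
have [g0 g0P] := convex_subdifferential_neq0 cf 0.
case E : (subgradient_bound f) fb ub => [L| |]// _ ub; last by have := ub _ _ g0P.
exists L => [|z g /ub]; last by rewrite lee_fin.
by apply: le_trans (_ : norm1 g0 <= _); [exact: sumr_ge0|have := ub _ _ g0P; rewrite lee_fin].
Qed.

(** A subgradient [g] at [u] gives [f u - f v <= dotp g (u - v)], and Hölder's inequality bounds the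
    right-hand side. *)
Lemma convex_lipschitz (R : realType) (d : nat) (f : 'rV[R]_d -> R) (L : R) :
  convex_function [set: convex_lmodType 'rV[R]_d] f ->
  (forall z g, subdifferential f z g -> norm1 g <= L) ->
  forall u v, f u - f v <= L * `|u - v|.
Proof.
move=> cf fL u v; have [g fg] := convex_subdifferential_neq0 cf u.
have := fg v; have := ler_norm_dotp g (v - u); rewrite distrC ler_norml.
have := ler_wpM2r (normr_ge0 (u - v)) (fL _ _ fg); lra.
Qed.

(** * Series with bounded partial sums *)

(** For nonnegative sequences this is summability, phrased so that no limit has to be handled. *)
Definition bounded_sums (R : realType) (u : nat -> R) : Prop :=
  exists B, forall n, \sum_(0 <= k < n) u k <= B.

Lemma bounded_sums_le (R : realType) (u v : nat -> R) :
  (forall t, u t <= v t) -> bounded_sums v -> bounded_sums u.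
Proof.
by move=> uv [B vB]; exists B => n; apply: le_trans (vB n); exact: ler_sum.
Qed.

Lemma bounded_sumsD (R : realType) (u v : nat -> R) :
  bounded_sums u -> bounded_sums v -> bounded_sums (fun t => u t + v t).
Proof.
move=> [B uB] [C vC]; exists (B + C) => n.
by rewrite big_split/= lerD.
Qed.

Lemma bounded_sumsZ (R : realType) (a : R) (u : nat -> R) :
  0 <= a -> bounded_sums u -> bounded_sums (fun t => a * u t).
Proof.
by move=> a0 [B uB]; exists (a * B) => n; rewrite -mulr_sumr ler_wpM2l.
Qed.

Lemma sum_shiftE (R : realType) (u : nat -> R) (k n : nat) :
  \sum_(0 <= t < n + k) u t =
  \sum_(0 <= t < k) u t + \sum_(0 <= t < n) u (t + k)%N.
Proof.
rewrite (big_cat_nat _ (leq_addl n k))//=; congr (_ + _).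
by rewrite -[in LHS](add0n k) big_addn addnK.
Qed.

Lemma bounded_sums_shift (R : realType) (k : nat) (u : nat -> R) :
  (forall t, 0 <= u t) -> bounded_sums u -> bounded_sums (fun t => u (t + k)%N).
Proof.
move=> u0 [B uB]; exists B => n; apply: le_trans (uB (n + k)%N).
by rewrite sum_shiftE lerDr sumr_ge0.
Qed.

Lemma bounded_sums_unshift (R : realType) (k : nat) (u : nat -> R) :
  (forall t, 0 <= u t) -> bounded_sums (fun t => u (t + k)%N) -> bounded_sums u.
Proof.
move=> u0 [B uB]; exists (\sum_(0 <= t < k) u t + B) => n.
apply: (@le_trans _ _ (\sum_(0 <= t < n + k) u t)).
  by rewrite addnC sum_shiftE lerDl sumr_ge0.
by rewrite sum_shiftE lerD2l.
Qed.

(** Summing the recursion bounds the partial sum up to [n + T] by its first [T] terms, plus [B],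
    plus [rho] times itself; as [rho < 1], this can be solved. *)
Lemma bounded_sums_contraction (R : realType) (T : nat) (rho : R) (u b : nat -> R) :
  0 <= rho -> rho < 1 -> (forall t, 0 <= u t) -> bounded_sums b ->
  (forall t, u (t + T)%N <= rho * u t + b t) -> bounded_sums u.
Proof.
move=> rho0 rho1 u0 [B bB] uT.
exists ((\sum_(0 <= t < T) u t + B) / (1 - rho)) => n.
have mono : \sum_(0 <= t < n) u t <= \sum_(0 <= t < n + T) u t.
  by rewrite addnC sum_shiftE lerDl sumr_ge0.
apply: (le_trans mono); rewrite ler_pdivlMr ?subr_gt0//.
have : \sum_(0 <= t < n) u (t + T)%N <= rho * \sum_(0 <= t < n) u t + B.
  apply: (@le_trans _ _ (\sum_(0 <= t < n) (rho * u t + b t))); first exact: ler_sum.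
  by rewrite big_split/= -mulr_sumr lerD2l.
have := ler_wpM2l rho0 mono; have := sum_shiftE u T n; lra.
Qed.

Lemma bounded_sums_tail (R : realType) (u : nat -> R) (e : R) :
  (forall t, 0 <= u t) -> bounded_sums u -> 0 < e ->
  exists n, forall m, (n <= m)%N -> \sum_(n <= k < m) u k < e.
Proof.
move=> u0 [B uB] e0; pose S := range (fun n => \sum_(0 <= k < n) u k).
have Sub : has_ubound S by exists B => _ [n _ <-].
have Ssup : has_sup S by split => //; exists 0; exists 0%N => //; rewrite big_geq.
have [_ [n _ <-] nS] := sup_adherent e0 Ssup; exists n => m nm.
have : \sum_(0 <= k < m) u k <= sup S by apply: ub_le_sup => //; exists m.
rewrite (big_cat_nat _ nm)//=; lra.
Qed.

Lemma bounded_sums_cvg0 (R : realType) (u : nat -> R) (e : R) :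
  (forall t, 0 <= u t) -> bounded_sums u -> 0 < e ->
  exists n, forall t, (n <= t)%N -> u t < e.
Proof.
move=> u0 uB e0; have [n nP] := bounded_sums_tail u0 uB e0.
exists n => t nt; apply: le_lt_trans (nP t.+1 (leqW nt)).
by rewrite big_nat_recr//= lerDr sumr_ge0.
Qed.

Lemma bounded_sums_powR (R : realType) (p : R) :
  1 < p -> bounded_sums (fun t => t.+2%:R `^ (- p)).
Proof.
move=> p1; pose q := p - 1; have q0 : 0 < q by rewrite subr_gt0.
exists (q^-1) => n.
have step (x : R) : 0 < x ->
    (x + 1) `^ (- p) <= q^-1 * (x `^ (- q) - (x + 1) `^ (- q)).
  move=> x0; have x10 : 0 < x + 1 by exact: addr_gt0.
  rewrite mulrC ler_pdivlMr// /powR !gt_eqF//.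
  have -> : - p * ln (x + 1) = - q * ln (x + 1) - ln (x + 1) by rewrite /q; ring.
  rewrite expRD expRN lnK//.
  have ln_step : (x + 1)^-1 <= ln (x + 1) - ln x.
    have xE : 1 + - (x + 1)^-1 = x / (x + 1) by field; rewrite gt_eqF.
    have : ln (1 + - (x + 1)^-1) <= - (x + 1)^-1.
      by apply: le_ln1Dx; rewrite ltrN2 invf_lt1// ltrDr.
    rewrite xE ln_div ?posrE//; lra.
  have -> : - q * ln x = - q * ln (x + 1) + q * (ln (x + 1) - ln x) by ring.
  rewrite (expRD _ (q * _)); set a := expR (- q * _).
  have a0 : 0 < a by exact: expR_gt0.
  have : 1 + q / (x + 1) <= expR (q * (ln (x + 1) - ln x)).
    by apply: le_trans (expR_ge1Dx _); rewrite lerD2l ler_pM2l.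
  rewrite -(ler_pM2l a0); lra.
clearbody q.
apply: (@le_trans _ _ (\sum_(0 <= k < n)
    - (q^-1 * (k.+2%:R `^ (- q)) - q^-1 * (k.+1%:R `^ (- q))))).
  apply: ler_sum => k _; have := step k.+1%:R (ltr0Sn _ _).
  by rewrite natr1 mulrBr opprB.
rewrite sumrN (telescope_sumr (fun k => q^-1 * k.+1%:R `^ (- q)))//.
by rewrite powR1 mulr1 opprB lerBlDr lerDl mulr_ge0 ?invr_ge0 ?ltW//.
Qed.

Lemma sqr_stepsize_bounded_sums (R : realType) (alpha c : R) (theta : nat -> R) :
  alpha < - (1 / 2) ->
  (forall t, (1 <= t)%N -> theta t = c * t%:R `^ alpha) ->
  bounded_sums (fun t => theta t ^+ 2).
Proof.
(* The shift by 2 matches the index [t.+2] of the power series and skips the arbitrary value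
   [theta 0]. *)
move=> ha thetaE; apply: (@bounded_sums_unshift _ 2) => [t|]; first exact: sqr_ge0.
have p1 : 1 < - (alpha *+ 2) by lra.
apply: (bounded_sums_le _ (bounded_sumsZ (sqr_ge0 c) (bounded_sums_powR p1))) => t.
rewrite addn2 thetaE// exprMn opprK expr2 mulr2n.
by rewrite (@powRD _ _ alpha alpha) ?pnatr_eq0 ?implybT.
Qed.

(** Since [alpha >= -1], the sequence [theta / c] dominates the harmonic one from index 1 on. *)
Lemma stepsize_unbounded_sums (R : realType) (alpha c : R) (theta : nat -> R) :
  -1 <= alpha -> 0 < c -> (forall t, 0 <= theta t) ->
  (forall t, (1 <= t)%N -> theta t = c * t%:R `^ alpha) ->
  ~ bounded_sums theta.
Proof.
move=> ha c0 theta0 thetaE /(bounded_sums_shift 1 theta0) thB.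
have [B hB] : bounded_sums (@harmonic R).
  have ci0 : 0 <= c^-1 by rewrite invr_ge0 ltW.
  apply: (bounded_sums_le _ (bounded_sumsZ ci0 thB)) => t.
  rewrite addn1 thetaE// mulKf ?gt_eqF// /harmonic/= -powR_inv1//.
  by rewrite ler_powR// ler1n.
apply: (@dvg_harmonic R); apply: nondecreasing_is_cvgn.
  by apply: nondecreasing_series => n _ _; exact: harmonic_ge0.
by exists B => _ [n _ <-]; exact: hB.
Qed.

(** * Products of column-stochastic matrices and consensus *)

Lemma min_positive_entry_lb (R : realType) (N : nat) (A : nat -> 'M[R]_N) :
  (0 < ereal_inf (range (fun t => min_positive_entry (A t))))%E ->
  exists2 a : R, 0 < a <= 1 & forall t i j, 0 < A t i j -> a <= A t i j.
Proof.
set m := ereal_inf _ => m0.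
have m_le t i j : 0 < A t i j -> (m <= (A t i j)%:E)%E.
  move=> Aij; apply: (@le_trans _ _ (min_positive_entry (A t))).
    by apply: ereal_inf_lbound; exists t.
  exact: (bigmin_le_cond +oo%E (fun p : 'I_N * 'I_N => (A t p.1 p.2)%:E)
    (j := (i, j))).
case: m m0 m_le => [m|_ m_le|]//.
  rewrite lte_fin => m0 m_le.
  (* Cutting the bound at 1 makes its powers decrease with the exponent, as needed for products of
     matrices. *)
  exists (Num.min m 1) => [|t i j /m_le]; first by rewrite lt_min m0 ltr01/= ge_min lexx orbT.
  by rewrite lee_fin ge_min => ->.
by exists 1 => [|t i j /m_le]; rewrite ?ltr01 ?lexx// leye_eq.
Qed.

Lemma mx_window_ge0 (R : realType) (N : nat) (A : nat -> 'M[R]_N) (t T : nat) i j :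
  (forall t i j, 0 <= A t i j) -> 0 <= mx_window A t T i j.
Proof.
move=> A0; elim: T i j => [|T IHT] i j /=; first by rewrite mxE ler0n.
by rewrite mxE; apply: sumr_ge0 => k _; rewrite mulr_ge0.
Qed.

(** A positive entry of the product contains a positive path of [T] factors, each at least [a]; the
    other paths contribute nonnegatively. *)
Lemma mx_window_entry_lb (R : realType) (N : nat) (A : nat -> 'M[R]_N) (a : R) :
  (forall t i j, 0 <= A t i j) -> 0 < a <= 1 ->
  (forall t i j, 0 < A t i j -> a <= A t i j) ->
  forall t T i j, 0 < mx_window A t T i j -> a ^+ T <= mx_window A t T i j.
Proof.
move=> A0 /andP[a0 a1] Aa t; elim=> [|T IHT] i j /=.
  by rewrite mxE expr0; case: (_ == _); rewrite ?ltxx.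
rewrite mxE => s0.
have term_ge0 (k : 'I_N) : 0 <= A (t + T)%N i k * mx_window A t T k j.
  by rewrite mulr_ge0// mx_window_ge0.
have [k k0] : exists k, 0 < A (t + T)%N i k * mx_window A t T k j.
  apply/existsP; rewrite -[X in is_true X]negbK negb_exists; apply/negP => /forallP n0.
  move: s0; rewrite big1 ?ltxx// => k _; apply/eqP.
  by rewrite eq_le term_ge0 andbT leNgt n0.
rewrite (bigD1 k)//=.
have Aik : 0 < A (t + T)%N i k.
  by rewrite lt_neqAle A0 andbT eq_sym; apply: contraTneq k0 => ->; rewrite mul0r ltxx.
have Wkj : 0 < mx_window A t T k j by rewrite -(pmulr_rgt0 _ Aik).
apply: ler_wpDr; first exact: sumr_ge0.
by rewrite exprS ler_pM ?exprn_ge0 ?Aa ?IHT// ltW.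
Qed.

Lemma row_neq0_entry (R : realType) (N : nat) (A : 'M[R]_N) i :
  (forall i j, 0 <= A i j) -> row i A != 0 -> exists j, 0 < A i j.
Proof.
move=> A0 /rV0Pn[j]; rewrite mxE => Aij; exists j.
by rewrite lt_neqAle eq_sym Aij A0.
Qed.

Lemma sum_stochastic (R : realType) (N : nat) (A : 'M[R]_N) (v : 'I_N -> R) :
  column_stochastic A -> \sum_i \sum_j A i j * v j = \sum_j v j.
Proof.
move=> [_ A1]; rewrite exchange_big; apply: eq_bigr => j _.
by rewrite -mulr_suml A1 mul1r.
Qed.

Lemma sumv_stochastic (R : realType) (V : lmodType R) (N : nat) (A : 'M[R]_N)
    (v : 'I_N -> V) :
  column_stochastic A -> \sum_i \sum_j A i j *: v j = \sum_j v j.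
Proof.
move=> [_ A1]; rewrite exchange_big; apply: eq_bigr => j _.
by rewrite -scaler_suml A1 scale1r.
Qed.

Lemma sum_norm_stochastic (R : realType) (V : normedModType R) (N : nat)
    (A : 'M[R]_N) (v : 'I_N -> V) :
  column_stochastic A -> \sum_i `|\sum_j A i j *: v j| <= \sum_j `|v j|.
Proof.
move=> As; rewrite -(sum_stochastic (fun j => `|v j|) As); apply: ler_sum => i _.
apply: le_trans (ler_norm_sum _ _ _) _; apply: ler_sum => j _.
by rewrite normrZ ger0_norm//; case: As.
Qed.

Lemma mx_window_iter (R : realType) (N : nat) (A : nat -> 'M[R]_N)
    (y : 'I_N -> nat -> R) :
  (forall i t, y i t.+1 = \sum_(j < N) A t i j * y j t) ->
  forall t T i, y i (t + T)%N = \sum_j mx_window A t T i j * y j t.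
Proof.
move=> yS t; elim=> [|T IHT] i /=.
  rewrite addn0 (bigD1 i)//= mxE eqxx mul1r big1 ?addr0// => j ji.
  by rewrite mxE eq_sym (negbTE ji) mul0r.
rewrite addnS yS.
transitivity (\sum_k \sum_j A (t + T)%N i k * (mx_window A t T k j * y j t)).
  by apply: eq_bigr => k _; rewrite IHT mulr_sumr.
rewrite exchange_big; apply: eq_bigr => j _; rewrite mxE mulr_suml.
by apply: eq_bigr => k _; rewrite mulrA.
Qed.

(** A column-stochastic matrix does not increase the sum of the norms, so the perturbations injected
    during the window simply add up. *)
Lemma mx_window_perturbed (R : realType) (V : normedModType R) (N : nat)
    (A : nat -> 'M[R]_N) (w p : 'I_N -> nat -> V) :
  (forall t, column_stochastic (A t)) ->
  (forall i t, w i t.+1 = \sum_(j < N) A t i j *: (w j t + p j t)) ->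
  forall t T, \sum_i `|w i (t + T)%N - \sum_j mx_window A t T i j *: w j t| <=
    \sum_(0 <= k < T) \sum_j `|p j (t + k)%N|.
Proof.
move=> As wS t; elim=> [|T IHT].
  rewrite big_geq// big1// => i _.
  rewrite addn0 (bigD1 i)//= mxE eqxx scale1r big1 ?addr0 ?subrr ?normr0// => j ji.
  by rewrite mxE eq_sym (negbTE ji) scale0r.
rewrite big_nat_recr//=.
apply: (@le_trans _ _ (\sum_j
    `|(w j (t + T)%N - \sum_k mx_window A t T j k *: w k t) + p j (t + T)%N|)).
  apply: le_trans (sum_norm_stochastic _ (As (t + T)%N)).
  rewrite le_eqVlt; apply/orP; left; apply/eqP/eq_bigr => i _; congr `| _ |.
  rewrite addnS wS; under [X in _ - X]eq_bigr => j _ do rewrite mxE scaler_suml.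
  rewrite exchange_big/= -sumrB; apply: eq_bigr => j _.
  under eq_bigr => k _ do rewrite -scalerA.
  by rewrite -scaler_sumr -scalerBr addrAC.
apply: le_trans (ler_sum _ (fun j _ => ler_normD _ _)) _.
by rewrite big_split/= lerD2r.
Qed.

(* Dobrushin contraction: after removing [delta] from every entry, two rows of
   [Q] are nonnegative of the same mass [rho], and the difference of the two
   averages is a double average of differences. *)
Lemma averages_contraction (R : realType) (V : normedModType R) (N : nat)
    (Q : 'I_N -> 'I_N -> R) (delta rho D : R) (z : 'I_N -> V) :
  (forall i j, delta <= Q i j) -> (forall i, \sum_j Q i j = 1) ->
  rho = 1 - N%:R * delta -> 0 < rho -> (forall k l, `|z k - z l| <= D) ->
  forall i j, `|\sum_k Q i k *: z k - \sum_k Q j k *: z k| <= rho * D.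
Proof.
move=> Qd Q1 rhoE rho0 zD i j; pose P i k := Q i k - delta.
have P0 i' k : 0 <= P i' k by rewrite subr_ge0.
have P1 i' : \sum_k P i' k = rho.
  by rewrite sumrB Q1 sumr_const card_ord rhoE mulr_natl.
have PE i' : \sum_k Q i' k *: z k = \sum_k P i' k *: z k + delta *: \sum_k z k.
  rewrite scaler_sumr -big_split/=; apply: eq_bigr => k _.
  by rewrite -scalerDl subrK.
(* The factor [rho] is the mass of either row of [P]; it lets both sums be written with the common
   weights [P i k * P j l]. *)
rewrite -(ler_pM2l rho0) -{1}(gtr0_norm rho0) -normrZ.
have -> : rho *: (\sum_k Q i k *: z k - \sum_k Q j k *: z k) =
    \sum_k \sum_l (P i k * P j l) *: (z k - z l).
  rewrite !PE opprD addrACA subrr addr0 scalerBr.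
  transitivity (\sum_k \sum_l (P i k * P j l) *: z k -
                \sum_k \sum_l (P i k * P j l) *: z l); last first.
    rewrite -sumrB; apply: eq_bigr => k _; rewrite -sumrB.
    by apply: eq_bigr => l _; rewrite scalerBr.
  congr (_ - _).
    rewrite scaler_sumr; apply: eq_bigr => k _.
    by rewrite -scaler_suml -mulr_sumr P1 scalerA mulrC.
  rewrite exchange_big/= scaler_sumr; apply: eq_bigr => l _.
  by rewrite -scaler_suml -mulr_suml P1 scalerA.
apply: (@le_trans _ _ (\sum_k \sum_l (P i k * P j l) * D)).
  apply: le_trans (ler_norm_sum _ _ _) _; apply: ler_sum => k _.
  apply: le_trans (ler_norm_sum _ _ _) _; apply: ler_sum => l _.
  by rewrite normrZ ger0_norm ?mulr_ge0// ler_wpM2l ?mulr_ge0.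
under eq_bigr => k _ do rewrite -mulr_suml -mulr_sumr P1.
by rewrite -!mulr_suml P1 mulrA.
Qed.

(** Induction on [T] through [(s + u)^2 <= 2 * (s^2 + u^2)]. *)
Lemma bounded_sums_sqr_sum (R : realType) (T : nat) (u : nat -> nat -> R) :
  (forall k, bounded_sums (fun t => u k t ^+ 2)) ->
  bounded_sums (fun t => (\sum_(0 <= k < T) u k t) ^+ 2).
Proof.
move=> uB; elim: T => [|T IHT].
  by exists 0 => n; rewrite big1// => k _; rewrite big_geq// expr0n.
apply: (bounded_sums_le _ (bounded_sumsZ (ler0n _ 2) (bounded_sumsD IHT (uB T)))).
move=> t; rewrite big_nat_recr//=; set s := \sum_(0 <= k < T) _.
have := sqr_ge0 (s - u T t); rewrite !expr2; lra.
Qed.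

(** The diameter of the family [z] in the norm of [V]. *)
Definition disagreement (R : realType) (V : normedModType R) (N : nat)
    (z : 'I_N -> V) : R :=
  \big[Num.max/0]_(p : 'I_N * 'I_N) `|z p.1 - z p.2|.

Lemma disagreement_ge0 (R : realType) (V : normedModType R) (N : nat)
    (z : 'I_N -> V) : 0 <= disagreement z.
Proof. exact: bigmax_ge_id. Qed.

Lemma le_disagreement (R : realType) (V : normedModType R) (N : nat)
    (z : 'I_N -> V) i j : `|z i - z j| <= disagreement z.
Proof. exact: (le_bigmax _ (fun p : 'I_N * 'I_N => `|z p.1 - z p.2|) (i, j)). Qed.

Lemma norm_average_sub_le (R : realType) (V : normedModType R) (N : nat)
    (z : 'I_N -> V) (q : 'I_N -> R) i :
  (forall j, 0 <= q j) -> \sum_j q j = 1 ->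
  `|\sum_j q j *: z j - z i| <= disagreement z.
Proof.
move=> q0 q1; rewrite -[z i]scale1r -q1 scaler_suml -sumrB.
apply: (@le_trans _ _ (\sum_j q j * disagreement z)); last first.
  by rewrite -mulr_suml q1 mul1r.
apply: le_trans (ler_norm_sum _ _ _) _; apply: ler_sum => j _.
by rewrite -scalerBr normrZ ger0_norm// ler_wpM2l// le_disagreement.
Qed.

Lemma push_sum_weight_mass (R : realType) (N : nat) (A : nat -> 'M[R]_N)
    (y : 'I_N -> nat -> R) :
  (forall t, column_stochastic (A t)) ->
  (forall i t, y i t.+1 = \sum_(j < N) A t i j * y j t) ->
  forall t, \sum_i y i t = \sum_i y i 0%N.
Proof.
move=> As yS; elim=> // t <-.
by under eq_bigr do rewrite yS; exact: sum_stochastic.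
Qed.

(** From time [T] on, the weights are a positive window applied to earlier weights, so each is at
    least [a ^+ T] times the conserved total mass. Before [T], a positive entry in every row loses
    at most a factor [a] per step. *)
Lemma push_sum_weight_lb (R : realType) (N : nat) (A : nat -> 'M[R]_N) (a : R) (T : nat)
    (y : 'I_N -> nat -> R) :
  (0 < N)%N ->
  (forall t, column_stochastic (A t)) ->
  (forall t i, row i (A t) != 0) ->
  0 < a <= 1 -> (forall t i j, 0 < A t i j -> a <= A t i j) ->
  (forall t, positive_mx (mx_window A t T)) ->
  (forall i, 0 < y i 0%N) ->
  (forall i t, y i t.+1 = \sum_(j < N) A t i j * y j t) ->
  exists2 eta : R, 0 < eta & forall i t, eta <= y i t.
Proof.
move=> N0 As Ar a01 Aa AT y0 yS; have [a0 a1] := andP a01.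
pose i0 := Ordinal N0.
have A0 t i j : 0 <= A t i j by case: (As t).
pose m := \big[Num.min/1]_i y i 0%N.
have m0 : 0 < m by apply: lt_bigmin.
have early t i : a ^+ t * m <= y i t.
  elim: t i => [|t IHt] i; first by rewrite mul1r; exact: bigmin_le.
  have [j Aij] := row_neq0_entry (A0 t) (Ar t i).
  have yt0 k : 0 <= y k t.
    by apply: le_trans (IHt k); rewrite mulr_ge0 ?exprn_ge0 ?(ltW a0) ?(ltW m0).
  rewrite yS (bigD1 j)//= exprS -mulrA; apply: ler_wpDr.
    by apply: sumr_ge0 => k _; rewrite mulr_ge0.
  by rewrite ler_pM ?Aa// ?mulr_ge0 ?exprn_ge0 ?(ltW a0) ?(ltW m0).
exists (Num.min (a ^+ T * m) (a ^+ T * \sum_i y i 0%N)).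
  rewrite lt_min !mulr_gt0 ?exprn_gt0//= (bigD1 i0)//= ltr_wpDr// sumr_ge0//.
  by move=> j _; exact: ltW.
move=> i t; have [Tt|tT] := leqP T t; last first.
  rewrite ge_min; apply/orP; left; apply: le_trans (early t i).
  by rewrite ler_pM2r// ler_wiXn2l ?(ltW a0) ?(ltnW tT).
rewrite ge_min; apply/orP; right.
rewrite -(push_sum_weight_mass As yS (t - T)%N) -(subnK Tt).
rewrite (mx_window_iter yS) addnK mulr_sumr.
apply: ler_sum => j _; rewrite ler_pM2r.
  by apply: (mx_window_entry_lb A0 a01 Aa); exact: AT.
by apply: lt_le_trans (early (t - T)%N j); rewrite mulr_gt0 ?exprn_gt0.
Qed.

(* Squaring the contraction [D (t + T) <= rho * D t + e t] and using convexity,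
   [(rho * D + e)^2 <= rho * D^2 + e^2 / (1 - rho)], gives a contraction of
   [D^2] with summable perturbation. *)
Lemma push_sum_disagreement (R : realType) (V : normedModType R) (N : nat)
    (A : nat -> 'M[R]_N) (a : R) (T : nat) (y : 'I_N -> nat -> R)
    (w p : 'I_N -> nat -> V) (b : nat -> R) :
  (0 < N)%N ->
  (forall t, column_stochastic (A t)) ->
  (forall t i, row i (A t) != 0) ->
  0 < a <= 1 -> (forall t i j, 0 < A t i j -> a <= A t i j) ->
  (forall t, positive_mx (mx_window A t T)) ->
  (forall i, 0 < y i 0%N) ->
  (forall i t, y i t.+1 = \sum_(j < N) A t i j * y j t) ->
  (forall i t, w i t.+1 = \sum_(j < N) A t i j *: (w j t + p j t)) ->
  (forall t, \sum_j `|p j t| <= b t) ->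
  bounded_sums (fun t => b t ^+ 2) ->
  bounded_sums (fun t => disagreement (fun i => (y i t)^-1 *: w i t) ^+ 2).
Proof.
move=> N0 As Ar a01 Aa AT y0 yS wS pb bB.
have [a0 a1] := andP a01.
have A0 t i j : 0 <= A t i j by case: (As t).
have [eta eta0 etaP] := push_sum_weight_lb N0 As Ar a01 Aa AT y0 yS.
have yt0 i t : 0 < y i t by exact: lt_le_trans (etaP i t).
pose Y := \sum_i y i 0%N.
have yY i t : y i t <= Y.
  rewrite /Y -(push_sum_weight_mass As yS t) (bigD1 i)//= lerDl.
  by apply: sumr_ge0 => j _; exact: ltW.
have Y0 : 0 < Y by exact: lt_le_trans (yY (Ordinal N0) 0%N).
(* [Q t] is the matrix acting on the ratios over one window; its rows sum to 1 because the weights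
   obey the same linear recursion. *)
pose Q t i j := (y i (t + T)%N)^-1 * (mx_window A t T i j * y j t).
have Q1 t i : \sum_j Q t i j = 1.
  by rewrite -mulr_sumr -(mx_window_iter yS) mulVf// gt_eqF.
(* Half of the entrywise lower bound of [Q]: this gives [N * delta <= 1/2], hence [rho > 0]
   strictly. *)
pose delta := Y^-1 * (a ^+ T * eta) / 2.
have delta0 : 0 < delta by rewrite !mulr_gt0 ?invr_gt0 ?exprn_gt0.
have Qdelta t i j : delta * 2 <= Q t i j.
  rewrite divfK ?pnatr_eq0// /Q ler_pM ?invr_ge0 ?mulr_ge0 ?exprn_ge0
    ?(ltW a0) ?(ltW eta0) ?(ltW Y0)//.
    by rewrite lef_pV2 ?posrE.
  by rewrite ler_pM ?exprn_ge0 ?(ltW a0) ?(ltW eta0)// (mx_window_entry_lb A0 a01 Aa) ?AT.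
pose rho := 1 - N%:R * delta.
have Nd : N%:R * (delta * 2) <= 1.
  apply: (@le_trans _ _ (\sum_j Q 0%N (Ordinal N0) j)); last by rewrite Q1.
  have -> : N%:R * (delta * 2) = \sum_(j < N) delta * 2.
    by rewrite sumr_const card_ord mulr_natl.
  exact: ler_sum.
have rho0 : 0 < rho by rewrite /rho; lra.
have rho1 : rho < 1 by rewrite /rho gtrBl mulr_gt0// ltr0n.
pose z t i := (y i t)^-1 *: w i t.
pose D t := disagreement (z t).
(* The factor 2 accounts for the remainders of the two indices being compared. *)
pose e t := 2 * eta^-1 * \sum_(0 <= k < T) b (t + k)%N.
have D0 t : 0 <= D t by exact: disagreement_ge0.
have b0 t : 0 <= b t by apply: le_trans (pb t); exact: sumr_ge0.
have e0 t : 0 <= e t.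
  by rewrite !mulr_ge0 ?invr_ge0 ?(ltW eta0)//; apply: sumr_ge0.
have DT t : D (t + T)%N <= rho * D t + e t.
  pose r i := w i (t + T)%N - \sum_j mx_window A t T i j *: w j t.
  have rb i : `|(y i (t + T)%N)^-1 *: r i| <= eta^-1 * \sum_(0 <= k < T) b (t + k)%N.
    rewrite normrZ ger0_norm ?invr_ge0 ?(ltW (yt0 _ _))//.
    apply: ler_pM => //; first by rewrite invr_ge0 ltW.
      by rewrite lef_pV2 ?posrE.
    apply: (@le_trans _ _ (\sum_(0 <= k < T) \sum_j `|p j (t + k)%N|)); last first.
      exact: ler_sum.
    apply: le_trans (mx_window_perturbed As wS t T).
    by rewrite (bigD1 i)//= lerDl sumr_ge0.
  have zE i : z (t + T)%N i = \sum_j Q t i j *: z t j + (y i (t + T)%N)^-1 *: r i.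
    rewrite /r scalerBr addrC scaler_sumr.
    under [X in _ - X + _]eq_bigr => j _.
      rewrite scalerA (_ : _ * _ = Q t i j * (y j t)^-1); last first.
        by rewrite /Q -!mulrA mulfV ?mulr1// gt_eqF.
      rewrite -scalerA; over.
    by rewrite subrK.
  apply: bigmax_le => [|[i j] _ /=]; first by apply: addr_ge0 => //; apply: mulr_ge0 => //; exact: ltW.
  rewrite !zE opprD addrACA; apply: le_trans (ler_normD _ _) _; apply: lerD.
    apply: (averages_contraction (delta := delta) (Q := Q t)) => //.
    - by move=> k l; apply: le_trans (Qdelta t k l); lra.
    - by move=> k l; exact: le_disagreement.
  apply: le_trans (ler_normB _ _) _; apply: le_trans (lerD (rb i) (rb j)) _.
  by rewrite /e -mulrA mulr2n mulrDl mul1r.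
have eB : bounded_sums (fun t => (1 - rho)^-1 * e t ^+ 2).
  apply: bounded_sumsZ; first by rewrite invr_ge0 subr_ge0 ltW.
  have c0 : 0 <= (2 * eta^-1) ^+ 2 by exact: sqr_ge0.
  have bkB k : bounded_sums (fun t => b (t + k)%N ^+ 2).
    exact: (bounded_sums_shift k (fun t => sqr_ge0 (b t)) bB).
  apply: (bounded_sums_le _ (bounded_sumsZ c0
    (bounded_sums_sqr_sum (u := fun k t => b (t + k)%N) T bkB))) => t.
  by rewrite -exprMn.
apply: (bounded_sums_contraction (ltW rho0) rho1 _ eB) => [t|t]; first exact: sqr_ge0.
rewrite -/(D _) -/(D _).
have r10 : 0 < 1 - rho by rewrite subr_gt0.
apply: (@le_trans _ _ ((rho * D t + e t) ^+ 2)).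
  rewrite ler_sqr ?nnegrE ?D0 ?DT//.
  by apply: addr_ge0 => //; apply: mulr_ge0 => //; exact: ltW.
rewrite -(ler_pM2l r10) mulrDr mulVKf ?gt_eqF//.
(* After multiplication by [1 - rho], the gap in the convexity inequality is a perfect square times
   [rho]. *)
rewrite -subr_ge0 (_ : _ - _ = rho * ((1 - rho) * D t - e t) ^+ 2); last by ring.
by rewrite mulr_ge0 ?sqr_ge0// ltW.
Qed.

(** * Quasi-Fejer sequences *)

Lemma norm1_le_norm (R : realType) (d : nat) (u : 'rV[R]_d) :
  norm1 u <= d%:R * `|u|.
Proof.
have -> : d%:R * `|u| = \sum_(l < d) `|u| by rewrite sumr_const card_ord mulr_natl.
by apply: ler_sum => l _; exact: ler_coord_norm.
Qed.

Lemma dotp_sqr_le_norm (R : realType) (d : nat) (u : 'rV[R]_d) :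
  dotp u u <= d%:R * `|u| ^+ 2.
Proof.
apply: le_trans (ler_norm _) _; apply: le_trans (ler_norm_dotp _ _) _.
by rewrite expr2 mulrA ler_wpM2r// norm1_le_norm.
Qed.

(** Bolzano-Weierstrass, from the compactness of a closed ball of the sup norm. *)
Lemma bounded_sequence_cluster (R : realType) (d : nat) (u : nat -> 'rV[R]_d) (M : R) :
  (forall n, `|u n| <= M) ->
  exists p, forall n e, 0 < e -> exists2 t, (n <= t)%N & `|u t - p| < e.
Proof.
move=> uM; pose K := [set v : 'rV[R]_d | `|v| <= M].
have Kc : compact K.
  apply: bounded_closed_compact.
    by exists M; split => [|r Mr v vM]; [exact: num_real|exact: le_trans vM (ltW Mr)].
  apply: (@closed_comp _ _ _ [set r : R | r <= M]); last exact: closed_le.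
  by move=> v _; exact: norm_continuous.
have [|p [_ pP]] := Kc (u @ \oo) _; first by exists 0%N => // n _; exact: uM.
exists p => n e e0.
have [|v [[t /= nt <-] /=]] :=
    pP [set u t | t in [set t | (n <= t)%N]] (ball p e) _ (nbhsx_ballx p e e0).
  by exists n => // t nt; exists t.
by rewrite -ball_normE /= distrC; exists t.
Qed.

(* Quasi-Fejer monotonicity towards every minimizer, together with the
   divergence of [\sum theta], makes some minimizer a cluster point of [s];
   monotonicity towards that very minimizer turns it into the limit. *)
Lemma quasi_fejer_cvg (R : realType) (d : nat) (F : 'rV[R]_d -> R) (C : R)
    (s : nat -> 'rV[R]_d) (theta eps : nat -> R) :
  (forall u v, F u - F v <= C * `|u - v|) ->
  (exists x, minimizer F x) ->
  (forall t, 0 <= theta t) -> ~ bounded_sums theta ->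
  (forall t, 0 <= eps t) -> bounded_sums eps ->
  (forall x, minimizer F x -> forall t,
    dotp (s t.+1 - x) (s t.+1 - x) <=
    dotp (s t - x) (s t - x) - theta t * (F (s t) - F x) + eps t) ->
  exists2 x, minimizer F x &
    forall e, 0 < e -> exists n, forall t, (n <= t)%N -> `|s t - x| < e.
Proof.
move=> FC [x0 x0min] theta0 thetaB eps0 epsB step.
pose q x t := dotp (s t - x) (s t - x).
have Fmin x t : minimizer F x -> 0 <= F (s t) - F x by move=> xm; rewrite subr_ge0.
have descent x n m : minimizer F x ->
    q x (m + n)%N + \sum_(0 <= k < m) theta (k + n)%N * (F (s (k + n)%N) - F x) <=
    q x n + \sum_(0 <= k < m) eps (k + n)%N.
  move=> xm; elim: m => [|m IHm]; first by rewrite !big_geq.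
  rewrite !big_nat_recr//= addSn; have := step x xm (m + n)%N.
  rewrite -!/(q _ _); lra.
have fejer x n t : minimizer F x -> (n <= t)%N ->
    q x t <= q x n + \sum_(n <= k < t) eps k.
  move=> xm nt; have := descent x n (t - n)%N xm.
  rewrite subnK// -[in X in \sum_(X <= k < t) _](add0n n) big_addn.
  apply: le_trans; rewrite lerDl; apply: sumr_ge0 => k _.
  by rewrite mulr_ge0// Fmin.
have [B epsb] := epsB.
have B0 : 0 <= B by have := epsb 0%N; rewrite big_geq.
have qb t : q x0 t <= q x0 0%N + B.
  by apply: le_trans (fejer x0 0%N t x0min (leq0n t)) _; rewrite lerD2l.
(* Adding 1 avoids a square root: [X <= (X + 1)^2] for [X >= 0]. *)
have sM t : `|s t| <= `|x0| + (q x0 0%N + B + 1).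
  have qs := qb t; have q0 : 0 <= q x0 0%N by exact: dotp_sqr_ge0.
  have sq := sqr_norm_le_dotp (s t - x0); rewrite -/(q x0 t) in sq.
  have : `|s t - x0| <= q x0 0%N + B + 1.
    rewrite -ler_sqr ?nnegrE//; last by rewrite !addr_ge0.
    by apply: (le_trans sq); apply: (le_trans qs); rewrite expr2; nra.
  by have := ler_normD (s t - x0) x0; rewrite subrK; lra.
(* If the gap to the minimum stayed at least [e] after time [n], the telescoped descent would bound
   the sums of [theta] by a multiple of [e^-1]. *)
have liminf n e : 0 < e -> exists2 t, (n <= t)%N & F (s t) < F x0 + e.
  move=> e0; apply: contrapT => /forall2NP noF; apply: thetaB.
  apply: (@bounded_sums_unshift _ n) => //; exists (e^-1 * (q x0 n + B)) => m.
  rewrite mulrC ler_pdivlMr// mulrC mulr_sumr.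
  apply: (@le_trans _ _ (\sum_(0 <= k < m) theta (k + n)%N * (F (s (k + n)%N) - F x0))).
    apply: ler_sum => k _; rewrite mulrC ler_wpM2l//.
    case: (noF (k + n)%N) => [|/negP]; first by rewrite leq_addl.
    by rewrite -leNgt; lra.
  have := descent x0 n m x0min; have := epsb (m + n)%N; rewrite sum_shiftE.
  have : 0 <= \sum_(0 <= t < n) eps t by exact: sumr_ge0.
  have := dotp_sqr_ge0 (s (m + n)%N - x0); rewrite -/(q _ _); lra.
have /choice[tau tauP] : forall n, exists t, (n <= t)%N /\ F (s t) < F x0 + n.+1%:R^-1.
  by move=> n; have [|t nt Ft] := liminf n n.+1%:R^-1; [rewrite invr_gt0|exists t].
have [p pP] := @bounded_sequence_cluster R d (s \o tau) _ (fun n => sM (tau n)).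
have C0 : 0 <= `|C| by [].
have pmin : minimizer F p.
  move=> z; apply: le_trans (x0min z); rewrite leNgt; apply/negP => lt_Fp.
  pose e := (F p - F x0) / (`|C| + 1) / 2.
  have e0 : 0 < e by rewrite !divr_gt0 ?subr_gt0// ltr_wpDl.
  have eE : (`|C| + 1) * (e * 2) = F p - F x0.
    by rewrite /e divfK// mulrC divfK// gt_eqF// ltr_wpDl.
  have [n _ /(_ n (leqnn n)) /= nP] := @near_infty_natSinv_lt R (PosNum e0).
  have [t nt st] := pP n e e0.
  have [_ Ft] := tauP t.
  have te : t.+1%:R^-1 <= n.+1%:R^-1 :> R by rewrite lef_pV2 ?posrE// ler_nat.
  have := FC p (s (tau t)); rewrite distrC.
  have := ler_wpM2r (normr_ge0 (s (tau t) - p)) (ler_norm C).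
  have := ler_wpM2l C0 (ltW st).
  have contra (Fs Ca CA Ce i j : R) : CA <= Ce -> Ca <= CA -> F p - Fs <= Ca ->
      Fs < F x0 + i -> i <= j -> j < e -> (Ce + e) * 2 = F p - F x0 -> False by lra.
  move=> Ce CA Ca; apply: (contra _ _ _ _ _ _ Ce CA Ca Ft te nP).
  by rewrite -eE; ring.
exists p => // e e0.
(* One half of [e ^+ 2] pays for the squared distance at the chosen time, the other for the later
   errors [eps]. *)
pose e2 := e ^+ 2 / 2; have e20 : 0 < e2 by rewrite divr_gt0 ?exprn_gt0.
have [n nP] := bounded_sums_tail eps0 epsB e20.
(* The cap at 1 gives [r^2 <= r]; the divisor absorbs the factor [d] between the squared sup norm
   and [dotp], and [d.+1] keeps it positive. *)
pose r := Num.min 1 (e2 / d.+1%:R).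
have r0 : 0 < r by rewrite lt_min ltr01 divr_gt0.
have [t nt st] := pP n r r0.
have ntau : (n <= tau t)%N by apply: leq_trans nt _; case: (tauP t).
exists (tau t) => k tk.
have qt : q p (tau t) <= e2.
  apply: le_trans (dotp_sqr_le_norm _) _.
  have : `|s (tau t) - p| ^+ 2 <= e2 / d.+1%:R.
    have [r1 re] : r <= 1 /\ r <= e2 / d.+1%:R by rewrite /r !ge_min !lexx orbT.
    apply: le_trans (_ : `|s (tau t) - p| <= _); last exact: le_trans (ltW st) re.
    by rewrite expr2 ler_piMl// (le_trans (ltW st)).
  rewrite ler_pdivlMr// mulrC; apply: le_trans.
  by rewrite ler_wpM2r ?sqr_ge0// ler_nat.
have tail : \sum_(tau t <= j < k) eps j < e2.
  apply: le_lt_trans (nP k (leq_trans ntau tk)).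
  by rewrite [leRHS](big_cat_nat ntau tk)//= lerDr sumr_ge0.
have qk := fejer p (tau t) k pmin tk.
rewrite -ltr_sqr ?nnegrE ?(ltW e0)//.
apply: le_lt_trans (sqr_norm_le_dotp _) _; rewrite -/(q p k).
rewrite (_ : e ^+ 2 = e2 + e2); last by rewrite /e2 -splitr.
lra.
Qed.

(** * The subgradient-push iteration *)

Lemma cvg_of_dist (R : realType) (d : nat) (u : nat -> 'rV[R]_d) (l : 'rV[R]_d) :
  (forall e, 0 < e -> exists n, forall t, (n <= t)%N -> `|u t - l| < e) ->
  u @ \oo --> l.
Proof.
move=> ul; apply/cvgrPdist_lt => e e0; have [n nP] := ul e e0.
by exists n => // t /= /nP; rewrite distrC.
Qed.

(** Subgradients taken at the scattered points [z i] serve as approximate ones at [s]. Replacing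
    [z i] by [s] costs [L i * D] twice, once in the value of [f i] and once in the pairing with
    [g i]. *)
Lemma sum_subgradient_lb (R : realType) (N d : nat) (f : 'I_N -> 'rV[R]_d -> R)
    (L : 'I_N -> R) (z g : 'I_N -> 'rV[R]_d) (s x : 'rV[R]_d) (D : R) :
  (forall i z g, subdifferential (f i) z g -> norm1 g <= L i) ->
  (forall i u v, f i u - f i v <= L i * `|u - v|) ->
  (forall i, 0 <= L i) ->
  (forall i, subdifferential (f i) (z i) (g i)) ->
  (forall i, `|s - z i| <= D) ->
  \sum_i f i s - \sum_i f i x - 2 * (\sum_i L i) * D <=
  dotp (\sum_i g i) (s - x).
Proof.
move=> fL f_lip L0 fg szD; rewrite dotp_suml mulr_sumr mulr_suml -!sumrB.
apply: ler_sum => i _.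
have := fg i x; have := f_lip i s (z i).
have := ler_norm_dotp (g i) (z i - s); rewrite distrC ler_norml => /andP[_ gz].
have := ler_wpM2r (normr_ge0 (s - z i)) (fL _ _ _ (fg i)).
have := ler_wpM2l (L0 i) (szD i).
have -> : dotp (g i) (x - z i) = - dotp (g i) (s - x) - dotp (g i) (z i - s).
  by rewrite -!dotpNr -dotpDr; congr dotp; apply/rowP => l; rewrite !mxE; ring.
lra.
Qed.

Lemma dotp_sub_scale (R : realType) (d : nat) (u v : 'rV[R]_d) (a : R) :
  dotp (u - a *: v) (u - a *: v) =
  dotp u u - 2 * a * dotp v u + a ^+ 2 * dotp v v.
Proof.
by rewrite !(dotpDl, dotpDr, dotpNl, dotpNr, dotpZl, dotpZr) (dotpC u v); ring.
Qed.

Theorem corollary5p4 (R : realType) (N d : nat)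
    (hN : (0 < N)%N) (hd : (0 < d)%N)
    (f : 'I_N -> 'rV[R]_d -> R)
    (f_convex : forall i,
      convex_function [set: convex_lmodType 'rV[R]_d] (f i))
    (f_bound : forall i, (subgradient_bound (f i) < +oo)%E)
    (f_min : exists x, minimizer (fun z => \sum_(i < N) f i z) x)
    (A : nat -> 'M[R]_N)
    (A_stoch : forall t, column_stochastic (A t))
    (A_rows : forall t i, row i (A t) != 0)
    (A_inf : (0 < ereal_inf (range (fun t => min_positive_entry (A t))))%E)
    (T : nat)
    (A_window : forall t, positive_mx (mx_window A t T))
    (alpha c : R)
    (halpha : -1 <= alpha < - (1 / 2)) (hc : 0 < c)
    (theta : nat -> R)
    (theta0 : 0 <= theta 0%N)
    (theta_pow : forall t, (1 <= t)%N -> theta t = c * t%:R `^ alpha)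
    (y : 'I_N -> nat -> R)
    (x w g : 'I_N -> nat -> 'rV[R]_d)
    (y_init : forall i, 0 < y i 0%N)
    (y_step : forall i t, y i t.+1 = \sum_(j < N) A t i j * y j t)
    (x_def : forall i t, x i t = w i t - theta t *: g i t)
    (g_subgrad : forall i t, subdifferential (f i) ((y i t)^-1 *: w i t) (g i t))
    (w_step : forall i t, w i t.+1 = \sum_(j < N) A t i j *: x j t) :
  exists xstar : 'rV[R]_d,
    minimizer (fun z => \sum_(i < N) f i z) xstar /\
    forall i,
      ((fun t => (y i t)^-1 *: w i t) @ \oo --> xstar) /\
      ((fun t => (y i t)^-1 *: x i t) @ \oo --> xstar).
Proof.
have [a a01 Aa] := min_positive_entry_lb A_inf.
have A0 t i j : 0 <= A t i j by case: (A_stoch t).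
have /choice[L LP] : forall i, exists L, 0 <= L /\
    forall z g, subdifferential (f i) z g -> norm1 g <= L.
  by move=> i; have [L] := subgradient_boundP (f_convex i) (f_bound i); exists L.
have L0 i : 0 <= L i by case: (LP i).
have fL i : forall z g, subdifferential (f i) z g -> norm1 g <= L i by case: (LP i).
have f_lip i := convex_lipschitz (f_convex i) (fL i).
pose G := \sum_i L i; have G0 : 0 <= G by exact: sumr_ge0.
have LG i : L i <= G by rewrite /G (bigD1 i)//= lerDl sumr_ge0.
have theta_ge0 t : 0 <= theta t.
  by case: t => // t; rewrite theta_pow// mulr_ge0 ?powR_ge0// ltW.
have [alpha1 alpha2] := andP halpha.
have theta2B := sqr_stepsize_bounded_sums alpha2 theta_pow.
have thetaB := stepsize_unbounded_sums alpha1 hc theta_ge0 theta_pow.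
have [eta eta0 etaP] := push_sum_weight_lb hN A_stoch A_rows a01 Aa A_window y_init y_step.
have y0 i t : 0 < y i t by exact: lt_le_trans (etaP i t).
pose Y := \sum_i y i 0%N.
have YE t : \sum_i y i t = Y by exact: push_sum_weight_mass A_stoch y_step t.
have Y0 : 0 < Y.
  by rewrite /Y (bigD1 (Ordinal hN))//= ltr_wpDr// sumr_ge0// => j _; exact: ltW.
pose z i t := (y i t)^-1 *: w i t.
pose D t := disagreement (z^~ t).
have D0 t : 0 <= D t by exact: disagreement_ge0.
have D2B : bounded_sums (fun t => D t ^+ 2).
  (* The subgradient step is treated as a perturbation of pure averaging, of total size at most
     [G * theta t]. *)
  apply: (push_sum_disagreement (p := fun i t => - (theta t *: g i t))
    (b := fun t => G * theta t) hN A_stoch A_rows a01 Aa A_window y_init y_step).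
  - by move=> i t; rewrite w_step; apply: eq_bigr => j _; rewrite x_def.
  - move=> t; rewrite mulrC mulr_sumr; apply: ler_sum => j _.
    rewrite normrN normrZ ger0_norm// ler_wpM2l//.
    exact: le_trans (ler_norm_norm1 _) (fL _ _ _ (g_subgrad j t)).
  - apply: (bounded_sums_le _ (bounded_sumsZ (sqr_ge0 G) theta2B)) => t.
    by rewrite exprMn.
pose s t := Y^-1 *: \sum_i w i t.
have sz i t : `|s t - z i t| <= D t.
  (* [s t] is a convex combination of the ratios, so it lies within their diameter of each of
     them. *)
  have -> : s t = \sum_j (Y^-1 * y j t) *: z j t.
    rewrite /s scaler_sumr; apply: eq_bigr => j _.
    by rewrite /z scalerA mulfK ?gt_eqF.
  apply: norm_average_sub_le => [j|]; first by rewrite mulr_ge0 ?invr_ge0 ?ltW.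
  by rewrite -mulr_sumr YE mulVf// gt_eqF.
have s_step t : s t.+1 = s t - (theta t / Y) *: \sum_i g i t.
  rewrite /s (eq_bigr _ (fun i _ => w_step i t)) (sumv_stochastic _ (A_stoch t)).
  rewrite (eq_bigr _ (fun i _ => x_def i t)) sumrB -scaler_sumr scalerBr scalerA.
  by rewrite (mulrC Y^-1).
(* Expanding the square in the step of [s] produces the inner product with coefficient
   [2 * (theta t / Y)], which becomes the step size of the Fejér inequality. *)
pose tau t := 2 * Y^-1 * theta t.
have Y20 : 0 < 2 * Y^-1 by rewrite mulr_gt0 ?invr_gt0.
have tau0 t : 0 <= tau t by rewrite mulr_ge0// ltW.
have tau2B : bounded_sums (fun t => tau t ^+ 2).
  apply: (bounded_sums_le _ (bounded_sumsZ (sqr_ge0 (2 * Y^-1)) theta2B)) => t.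
  by rewrite exprMn.
have tauB : ~ bounded_sums tau.
  have Y2i0 : 0 <= (2 * Y^-1)^-1 by rewrite invr_ge0 ltW.
  move=> /(bounded_sumsZ Y2i0)/bounded_sums_le tB; apply: thetaB; apply: tB => t.
  by rewrite mulKf// gt_eqF.
(* The first term bounds the cross error [2 * tau * G * D] by [2 * tau * D <= tau^2 + D^2]; the
   second dominates the squared step [(tau / 2)^2 * G^2]. *)
pose eps t := G * (tau t ^+ 2 + D t ^+ 2) + G ^+ 2 * tau t ^+ 2.
have eps0 t : 0 <= eps t.
  by rewrite addr_ge0// mulr_ge0// ?addr_ge0// sqr_ge0.
have epsB : bounded_sums eps.
  apply: bounded_sumsD; first exact: (bounded_sumsZ G0 (bounded_sumsD tau2B D2B)).
  exact: (bounded_sumsZ (sqr_ge0 G) tau2B).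
pose F u := \sum_(i < N) f i u.
have F_lip u v : F u - F v <= G * `|u - v|.
  by rewrite -sumrB mulr_suml; apply: ler_sum => i _; exact: f_lip.
have descent xm : minimizer F xm -> forall t,
    dotp (s t.+1 - xm) (s t.+1 - xm) <=
    dotp (s t - xm) (s t - xm) - tau t * (F (s t) - F xm) + eps t.
  move=> _ t; rewrite s_step addrAC dotp_sub_scale.
  have gg : dotp (\sum_i g i t) (\sum_i g i t) <= G ^+ 2.
    apply: dotp_sqr_le; apply: le_trans (norm1_sum _) _.
    by apply: ler_sum => i _; exact: fL (g_subgrad i t).
  have lb := sum_subgradient_lb (s := s t) xm fL f_lip L0
    (fun i => g_subgrad i t) (fun i => sz i t).
  rewrite -/(F _) -/(F _) -/G in lb.
  have tauE : theta t / Y = tau t / 2 by rewrite /tau; field; rewrite gt_eqF.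
  rewrite tauE.
  have := ler_wpM2l (tau0 t) lb; have := ler_wpM2l (sqr_ge0 (tau t / 2)) gg.
  have := mulr_ge0 G0 (sqr_ge0 (tau t - D t)).
  have := mulr_ge0 (sqr_ge0 G) (sqr_ge0 (tau t)).
  rewrite /eps; move: (dotp _ _) (dotp _ _) (dotp _ _) => p1 p2 p3.
  nra.
have [xs xs_min s_cvg] := quasi_fejer_cvg F_lip f_min tau0 tauB eps0 epsB descent.
exists xs; split=> // i.
have D_lt e : 0 < e -> exists n, forall t, (n <= t)%N -> D t < e.
  move=> e0; have [n nP] := bounded_sums_cvg0 (fun t => sqr_ge0 (D t)) D2B (exprn_gt0 2 e0).
  by exists n => t /nP; rewrite ltr_sqr ?nnegrE// ltW.
have z_cvg e : 0 < e -> exists n, forall t, (n <= t)%N -> `|z i t - xs| < e.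
  move=> e0; have e20 : 0 < e / 2 by rewrite divr_gt0.
  have [n nP] := s_cvg _ e20; have [m mP] := D_lt _ e20.
  exists (maxn n m) => t; rewrite geq_max => /andP[/nP snear /mP Dnear].
  have -> : z i t - xs = (s t - xs) - (s t - z i t).
    by apply/rowP => l; rewrite !mxE; ring.
  by have := ler_normB (s t - xs) (s t - z i t); have := sz i t; lra.
split; first exact: cvg_of_dist.
apply: cvg_of_dist => e e0; have e20 : 0 < e / 2 by rewrite divr_gt0.
have [n nP] := z_cvg _ e20.
(* The ratios of [x] and [w] differ by at most [theta t * (G / eta)], and [theta] tends to 0; the
   added 1 keeps the divisor [k] positive. *)
pose k := eta^-1 * G + 1.
have k0 : 0 < k by rewrite ltr_wpDl// mulr_ge0// invr_ge0 ltW.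
have ek0 : 0 < e / 2 / k by rewrite divr_gt0.
have [m mP] := bounded_sums_cvg0 (fun t => sqr_ge0 (theta t)) theta2B (exprn_gt0 2 ek0).
exists (maxn n m) => t; rewrite geq_max => /andP[/nP znear /mP].
rewrite ltr_sqr ?nnegrE ?(ltW ek0)// ltr_pdivlMr// => theta_small.
have -> : (y i t)^-1 *: x i t - xs = (z i t - xs) - ((y i t)^-1 * theta t) *: g i t.
  by rewrite x_def scalerBr scalerA addrAC.
apply: le_lt_trans (ler_normB _ _) _.
rewrite normrZ ger0_norm ?mulr_ge0 ?invr_ge0 ?(ltW (y0 _ _))//.
have g_le : `|g i t| <= G.
  apply: le_trans (ler_norm_norm1 _) _.
  exact: le_trans (fL _ _ _ (g_subgrad i t)) (LG i).
have y_le : (y i t)^-1 <= eta^-1 by rewrite lef_pV2 ?posrE.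
have : (y i t)^-1 * theta t * `|g i t| <= theta t * k.
  rewrite mulrAC mulrC ler_wpM2l// /k ler_wpDr//.
  by apply: ler_pM => //; rewrite invr_ge0 ltW.
lra.
Qed.
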